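(* Every $3$-graph $G$ on $n$ vertices with $\delta_1(G) \geq \frac{1}{2}\binom{n-1}{2}+1$ contains a spanning component.
   Context: A $3$-graph $G$ consists of a vertex set $V(G)$ and a set $E(G)$ of $3$-element subsets of $V(G)$ (edges). The minimum (vertex) degree $\delta_1(G)$ is the largest integer $m$ such that every vertex lies in at least $m$ edges. The line graph $L(G)$ is the graph on vertex set $E(G)$ in which $e,f$ are adjacent whenever $|e\cap f| = 2$. A subgraph of $G$ is (tightly) connected if it has no isolated vertices and its edges induce a connected subgraph of $L(G)$. A (tight) component is an edge-maximal connected subgraph. A component is spanning if its vertex set is all of $V(G)$. *)

(* Defs.v *)
From HB Require Import structures.
From mathcomp Require Import all_boot all_order all_algebra.

Set Implicit Arguments.
Unset Strict Implicit.
Unset Printing Implicit Defensive.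

Record tgraph (T : finType) := TGraph {
  verts : {set T};
  edges : {set {set T}};
  edges_card3 : forall e, e \in edges -> #|e| = 3;
  edges_sub : forall e, e \in edges -> e \subset verts
}.

Definition degree (T : finType) (G : tgraph T) (v : T) : nat :=
  #|[set e in edges G | v \in e]|.

(* Degrees never exceed #|edges G|, so bounding m by it loses nothing as soon
   as verts G is nonempty. *)
Definition min_degree (T : finType) (G : tgraph T) : nat :=
  \max_(m < #|edges G|.+1 | [forall v in verts G, m <= degree G v]) m.

Definition line_graph (T : finType) (G : tgraph T) : rel {set T} :=
  [rel e f | [&& e \in edges G, f \in edges G & #|e :&: f| == 2]].

Definition induced (V : finType) (r : rel V) (A : {set V}) : rel V :=
  [rel x y | [&& x \in A, y \in A & r x y]].

(* The graph with no vertices does not count as connected. *)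
Definition induces_connected (V : finType) (r : rel V) (A : {set V}) : Prop :=
  A != set0 /\ {in A &, forall x y, connect (induced r A) x y}.

Definition subgraph (T : finType) (H G : tgraph T) : Prop :=
  verts H \subset verts G /\ edges H \subset edges G.

Definition no_isolated (T : finType) (H : tgraph T) : Prop :=
  forall v, v \in verts H -> exists2 e, e \in edges H & v \in e.

Definition connected_subgraph (T : finType) (G H : tgraph T) : Prop :=
  [/\ subgraph H G, no_isolated H
    & induces_connected (line_graph G) (edges H)].

Definition tight_component (T : finType) (G C : tgraph T) : Prop :=
  connected_subgraph G C /\
  forall H : tgraph T, connected_subgraph G H ->
    edges C \subset edges H -> edges H = edges C.

Definition spanning (T : finType) (G C : tgraph T) : Prop :=
  verts C = verts G.

(* Main.v *)
Require Import Defs.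
From HB Require Import structures.
From mathcomp Require Import all_boot all_order all_algebra.
From mathcomp Require Import zify lra.
Import Order.TTheory GRing.Theory Num.Theory.
Local Open Scope ring_scope.

(** Colour each pair of vertices contained in an edge by the tight component of
    that edge, so that edges are monochromatic triangles.  By averaging, every
    vertex [x] has more than [n/2] neighbours in some colour.  Choose a vertex
    [y] and a colour (red) so that the number of red neighbours of [y] is as
    large as possible.  If red misses a vertex [x], let blue be a colour in
    which [x] has more than [n/2] neighbours.  Since no pair lying in the links
    of both [x] and [y] is red, counting the pairs in these two links shows
    that [x] has strictly more blue neighbours than [y] has red ones, against
    the choice of [y].  Hence red is spanning. *)

Section TightComponents.
Local Open Scope nat_scope.
Set Implicit Arguments.
Unset Strict Implicit.

Variables (T : finType) (G : tgraph T).
Implicit Types (e f g : {set T}) (x y u v w : T).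

(** * Links and colour neighbourhoods *)

Definition triple x u v : {set T} := x |: [set u; v].

Lemma in_triple x u v w :
  (w \in triple x u v) = [|| w == x, w == u | w == v].
Proof. by rewrite !inE. Qed.

Lemma triple_swap x u v : triple x u v = triple x v u.
Proof. by rewrite /triple (setUC [set u]). Qed.

Lemma triple_rot x u v : triple x u v = triple u x v.
Proof. by rewrite /triple setUCA. Qed.

(** Ordered pairs: each edge at [x] is counted twice, which absorbs the factor 1/2 of the degree
    condition. *)
Definition link x : {set T * T} := [set p | triple x p.1 p.2 \in edges G].

Definition colink x y : {set T} := [set w | triple x y w \in edges G].

Definition line_class e : {set {set T}} :=
  [set f in edges G | connect (line_graph G) e f].

(** The neighbourhood of [x] in the colour of [e]. *)
Definition nbr e x : {set T} :=
  [set u | (u != x) &&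
    [exists f in edges G,
      [&& connect (line_graph G) e f, x \in f & u \in f]]].

Lemma nbrP e x u :
  reflect (u != x /\ exists f, [/\ f \in edges G, connect (line_graph G) e f,
                                 x \in f & u \in f])
          (u \in nbr e x).
Proof.
rewrite inE; apply: (iffP andP) => -[ux].
  by case/existsP=> f /andP[fE /and3P[]]; split=> //; exists f.
by case=> f [*]; split=> //; apply/existsP; exists f; apply/and4P.
Qed.

Lemma triple_neq x u v : triple x u v \in edges G ->
  [/\ u != x, v != x & u != v].
Proof.
move/edges_card3; rewrite /triple cardsU1 cards2 !inE negb_or (eq_sym u x).
by rewrite (eq_sym v x); case: (x == u); case: (x == v); case: (u == v).
Qed.

Lemma line_graph_sym : symmetric (line_graph G).
Proof. by move=> e f; rewrite /line_graph /= setIC andbCA. Qed.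

Lemma connect_line_sym : connect_sym (line_graph G).
Proof. exact: sym_connect_sym line_graph_sym. Qed.

(* This makes the colour of a pair of vertices well defined. *)
Lemma connect_common_pair f g x u : f \in edges G -> g \in edges G ->
  u != x -> x \in f -> u \in f -> x \in g -> u \in g ->
  connect (line_graph G) f g.
Proof.
move=> fE gE ux xf uf xg ug; have [->|fg] := eqVneq f g; first exact: connect0.
apply: connect1; rewrite /line_graph /= fE gE /= eqn_leq; apply/andP; split.
  rewrite leqNgt; apply: contraNN fg => lt2.
  have sf : f :&: g == f.
    by rewrite eqEcard subsetIl (edges_card3 fE).
  have sg : f :&: g == g.
    by rewrite eqEcard subsetIr (edges_card3 gE).
  by rewrite -(eqP sf) (eqP sg).
have <- : #|[set x; u]| = 2 by rewrite cards2 eq_sym ux.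
apply: subset_leq_card; apply/subsetP=> w; rewrite !inE.
by case/orP=> /eqP->; apply/andP.
Qed.

Lemma nbr_connect e x u f : u \in nbr e x -> f \in edges G ->
  x \in f -> u \in f -> connect (line_graph G) e f.
Proof.
case/nbrP=> ux [g [gE eg xg ug]] fE xf uf.
exact: connect_trans eg (connect_common_pair gE fE ux xg ug xf uf).
Qed.

Lemma mem_nbr e f x u : f \in edges G -> connect (line_graph G) e f ->
  x \in f -> u \in f -> u != x -> u \in nbr e x.
Proof. by move=> *; apply/nbrP; split=> //; exists f. Qed.

Lemma nbr_sym e x u : (u \in nbr e x) = (x \in nbr e u).
Proof.
by apply/nbrP/nbrP=> -[ne [f [fE ef a b]]]; (split; first by rewrite eq_sym);
  exists f.
Qed.

Lemma nbr_sub e x : nbr e x \subset verts G :\ x.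
Proof.
apply/subsetP=> u /nbrP[ux [f [fE _ _ uf]]].
by rewrite !inE ux (subsetP (edges_sub fE)).
Qed.

(** The pairs [xu] and [xv] lie in a common edge, hence have the same colour. *)
Lemma nbr_link e x u v : triple x u v \in edges G ->
  (u \in nbr e x) = (v \in nbr e x).
Proof.
move=> E; have [ux vx _] := triple_neq E.
by apply/idP/idP=> H; apply: (mem_nbr E); rewrite ?in_triple ?eqxx ?orbT //;
  apply: (nbr_connect H E); rewrite in_triple eqxx ?orbT.
Qed.

(** * Link counting and majority colours *)

Lemma degree_link x : (degree G x).*2 <= #|link x|.
Proof.
rewrite /degree -muln2 -sum_nat_const.
rewrite -[#|link x|]sum1_card.
rewrite (partition_big (fun p : T * T => triple x p.1 p.2)
  (fun e => e \in [set e in edges G | x \in e])) /=; last first.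
  by move=> p; rewrite !inE eqxx /= andbT.
apply: leq_sum => e; rewrite inE => /andP[eE xe].
have /eqP/cards2P[u [v [uv ex]]] : #|e :\ x| = 2.
  by have := cardsD1 x e; rewrite xe (edges_card3 eE) => -[].
have tE : triple x u v = e by rewrite /triple -ex setD1K.
rewrite sum1_card.
have <- : #|[set (u, v); (v, u)]| = 2.
  by rewrite cards2 xpair_eqE negb_and uv.
apply: subset_leq_card; apply/subsetP=> p; rewrite !inE unfold_in.
by case/orP=> /eqP-> /=; rewrite inE /= 1?(triple_swap x v u) tE eE eqxx.
Qed.

Lemma link_le_colink x d :
  (forall u, u \in verts G :\ x -> #|colink x u| <= d) ->
  #|link x| <= #|verts G :\ x| * d.
Proof.
move=> le_d; rewrite -sum1_card.
rewrite (partition_big (fun p : T * T => p.1)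
  (fun u => u \in verts G :\ x)) /=; last first.
  move=> [u v]; rewrite inE /= => E; have [ux _ _] := triple_neq E.
  by rewrite !inE ux (subsetP (edges_sub E)) // in_triple eqxx orbT.
rewrite -sum_nat_const; apply: leq_sum => u /le_d; apply: leq_trans.
rewrite sum1_card -[#|colink x u|]mul1n -(cards1 u) -cardsX.
apply: subset_leq_card; apply/subsetP=> -[u' v]; rewrite unfold_in !inE /=.
by case/andP=> E /eqP eu; rewrite -eu eqxx.
Qed.

(** All edges through [x] and [u] have one colour, in which [x] sees [colink x u]; the strict
    inequality comes from [u] itself. *)
Lemma colink_nbr x u : colink x u != set0 ->
  exists2 e, e \in edges G & #|colink x u| < #|nbr e x|.
Proof.
case/set0Pn=> w; rewrite inE => E; exists (triple x u w) => //.
have [ux wx uw] := triple_neq E.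
have u_notin : u \notin colink x u.
  by apply/negP; rewrite inE => /triple_neq[_ _]; rewrite eqxx.
apply: (@leq_trans #|u |: colink x u|); first by rewrite cardsU1 u_notin.
apply: subset_leq_card; apply/subsetP=> v /setU1P[->|].
  by apply: (mem_nbr E); rewrite ?in_triple ?eqxx ?orbT.
rewrite inE => E'; have [_ vx uv] := triple_neq E'.
apply: (mem_nbr E'); rewrite ?in_triple ?eqxx ?orbT //.
by apply: (connect_common_pair E E' ux); rewrite ?in_triple ?eqxx ?orbT.
Qed.

Hypothesis deg_large : forall v, v \in verts G ->
  'C(#|verts G|.-1, 2) + 2 <= (degree G v).*2.

Lemma bin2_double k : 'C(k.+1, 2) * 2 = k.+1 * k.
Proof. by rewrite muln2 bin2 /= halfK oddM /= andNb subn0. Qed.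

(** Averaging the link over the m = n - 1 other vertices gives a [u] whose codegree c with [x]
    satisfies m(m - 1) + 4 <= 2mc, so 2c >= m. The extra neighbour from [colink_nbr] lifts this
    above n/2. *)
Lemma majority_nbr x : x \in verts G ->
  exists2 e, e \in edges G & #|verts G| < #|nbr e x|.*2.
Proof.
move=> xV; set n := #|verts G|.
have nx : n = #|verts G :\ x|.+1 by rewrite /n (cardsD1 x) xV.
have := leq_trans (deg_large xV) (degree_link x); rewrite -/n => deg_x.
have [u uV u_max] : exists2 u, u \in verts G :\ x &
    forall v, v \in verts G :\ x -> #|colink x v| <= #|colink x u|.
  case: (set_0Vmem (verts G :\ x)) => [V0|[u0 u0V]].
    have : #|link x| <= #|verts G :\ x| * 0.
      by apply: link_le_colink => u; rewrite V0 inE.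
    by rewrite muln0 => /(leq_trans deg_x); rewrite addn2.
  by case: (arg_maxnP (fun u => #|colink x u|) u0V) => u uV um; exists u.
have := leq_trans deg_x (link_le_colink u_max).
move: nx; set m := #|verts G :\ x| => nx; rewrite nx /= => le_m.
have lt_c : m <= #|colink x u|.*2.
  move: le_m; case: (m) => [//|k].
  by have := bin2_double k; move: 'C(_, _) => b; nia.
have [c0|c0] := eqVneq (colink x u) set0.
  by move: le_m; rewrite c0 cards0; lia.
by have [e eE lt_e] := colink_nbr c0; exists e => //; lia.
Qed.

(** * Comparing the links of two vertices *)

Lemma colinkC x y : colink x y = colink y x.
Proof. by apply/setP=> w; rewrite !inE triple_rot. Qed.

Lemma card_setU_le (U : finType) (A B : {set U}) : #|A :|: B| <= #|A| + #|B|.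
Proof. by rewrite cardsU leq_subr. Qed.

Lemma link_split x y :
  #|link x| <= #|link x :&: setX [set~ y] [set~ y]| + #|colink x y|.*2.
Proof.
have -> : #|colink x y|.*2 = #|setX [set y] (colink x y)|
                           + #|setX (colink x y) [set y]|.
  by rewrite !cardsX cards1 mul1n muln1 addnn.
set S1 := _ :&: _; set S2 := setX _ _; set S3 := setX _ _.
have sub : link x \subset S1 :|: S2 :|: S3.
  apply/subsetP=> -[u v]; rewrite inE /= => E; rewrite /S1 /S2 /S3 !inE /=.
  have [uy|uy] := eqVneq u y; first by rewrite -uy E orbT.
  have [vy|vy] := eqVneq v y; last by rewrite E.
  by rewrite -vy (triple_swap x v u) E !orbT.
rewrite addnA; apply: leq_trans (subset_leq_card sub) _.
by apply: leq_trans (card_setU_le _ _) (leq_add (card_setU_le _ _) _).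
Qed.

(* With [A = nbr e' x], [B = nbr e y] and [V' = V \ {x, y}], call [P a b] the
   four cells of [V'] cut out by [A] and [B].  No pair of either link joins
   opposite cells, and a pair in both links avoids [B], hence lies inside
   [A \ B] or inside the complement of [A] and [B].  The codegree of [x] and [y]
   is at most the size of one of the last two cells.  All counts are of ordered
   pairs. *)
Lemma missing_nbr_lt e e' x y : x \in verts G -> y \in verts G ->
  nbr e x = set0 -> #|verts G| < #|nbr e y|.*2 ->
  #|verts G| < #|nbr e' x|.*2 -> #|nbr e y| < #|nbr e' x|.
Proof.
move=> xV yV ex0 majy majx.
have xy : x != y.
  by apply: contraTneq majy => <-; rewrite ex0 cards0.
have xB : x \notin nbr e y by rewrite nbr_sym ex0 inE.
set A := nbr e' x in majx *; set B := nbr e y in majy xB *.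
have [V' defV'] : {V' | V' = verts G :\ x :\ y} by exists (verts G :\ x :\ y).
have inV u : (u \in V') = [&& u != y, u != x & u \in verts G].
  by rewrite defV' !inE.
have cV : #|verts G| = #|V'|.+2.
  by rewrite defV' (cardsD1 x) xV (cardsD1 y (_ :\ x)) !inE eq_sym xy yV.
have VA : A :\ y \subset V' by rewrite defV'; apply: setSD; exact: nbr_sub.
have VB : B \subset V'.
  apply/subsetP=> u uB; have /setD1P[uy uV] := subsetP (nbr_sub e y) u uB.
  by rewrite inV uy uV andbT; apply: contraNneq xB => <-.
pose P a b := [set u in V' | ((u \in A) == a) && ((u \in B) == b)].
have inP a b u :
    (u \in P a b) = [&& u \in V', (u \in A) == a & (u \in B) == b].
  by rewrite in_set.
have cVP : #|V'| = #|P true true| + #|P true false| + #|P false true|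
                 + #|P false false|.
  rewrite -(cardsID A V') -(cardsID B (V' :&: A)) -(cardsID B (V' :\: A)).
  rewrite !addnA; congr (_ + _ + _ + _); apply: eq_card => u;
  rewrite inP !(in_setI, in_setD);
  by case: (u \in A); case: (u \in B); rewrite ?andbT ?andbF.
(* [y] may lie in [A] but is outside [V'], hence the extra term; [B] contains neither [x] nor
   [y]. *)
have cA : #|A| = (y \in A) + (#|P true true| + #|P true false|).
  rewrite (cardsD1 y) -(cardsID B (A :\ y)); congr (_ + (_ + _));
  apply: eq_card => u; have := subsetP VA u;
  rewrite inP !(in_setI, in_setD, in_set1); have := inV u;
  case: (u == y) => /= [->|_]; rewrite ?andbF //=;
  by case: (u \in A) => /=; rewrite ?andbF // => ->; case: (u \in B).
have cB : #|B| = #|P true true| + #|P false true|.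
  rewrite -(cardsID A B); congr (_ + _);
  apply: eq_card => u; have := subsetP VB u; rewrite inP !(in_setI, in_setD);
  by case: (u \in B) => //=; rewrite ?andbF // => ->; case: (u \in A).
(* Otherwise [f] would have colour [e], making [y] a neighbour of [x] in a colour that misses
   [x]. *)
have notB f u : f \in edges G -> x \in f -> y \in f -> u \in f ->
    u \notin B.
  move=> fE xf yf uf; apply/negP=> uB.
  have ef := nbr_connect uB fE yf uf.
  by have := mem_nbr fE ef xf yf; rewrite ex0 inE eq_sym xy => /(_ isT).
have VE f u : f \in edges G -> u \in f -> u != x -> u != y -> u \in V'.
  by move=> fE uf ux uy; rewrite inV ux uy (subsetP (edges_sub fE)).
have codeg : #|colink x y| <= #|P (y \in A) false|.
  apply: subset_leq_card; apply/subsetP=> w; rewrite inE => E.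
  have [_ wx yw] := triple_neq E.
  have wV : w \in V'.
    by rewrite (VE _ _ E) ?in_triple ?eqxx ?orbT // eq_sym.
  rewrite inP wV -(nbr_link e' E) eqxx /= eqbF_neg.
  by apply: (notB _ _ E); rewrite in_triple eqxx ?orbT.
pose Lx := link x :&: setX [set~ y] [set~ y].
pose Ly := link y :&: setX [set~ x] [set~ x].
have LxP u v : (u, v) \in Lx ->
    [/\ u \in V', v \in V' & (u \in A) = (v \in A)].
  rewrite in_setI in_setX in_set /= !in_setC1 => /and3P[E uy vy].
  have [ux vx _] := triple_neq E.
  rewrite !inV uy vy ux vx (nbr_link e' E) !(subsetP (edges_sub E)) //;
  by rewrite in_triple eqxx ?orbT.
have LyP u v : (u, v) \in Ly ->
    [/\ u \in V', v \in V' & (u \in B) = (v \in B)].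
  rewrite in_setI in_setX in_set /= !in_setC1 => /and3P[E ux vx].
  have [uy vy _] := triple_neq E.
  rewrite !inV uy vy ux vx (nbr_link e E) !(subsetP (edges_sub E)) //;
  by rewrite in_triple eqxx ?orbT.
have capL : #|Lx :&: Ly| <= #|P true false| ^ 2 + #|P false false| ^ 2.
  rewrite -!mulnn -!cardsX; apply: leq_trans (card_setU_le _ _).
  apply: subset_leq_card; apply/subsetP=> -[u v] /setIP[uvx uvy].
  have [uV vV uvA] := LxP _ _ uvx; have [_ _ uvB] := LyP _ _ uvy.
  (* If [yu] had colour [e], so would the edge [yuv], and then [xuv] through the shared pair
     [uv]. *)
  have uB : u \notin B.
    apply/negP=> uB; move: uvx uvy.
    rewrite ![_ \in _ :&: _]in_setI !in_set /= => /andP[Ex _] /andP[Ey _].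
    have [_ _ uv] := triple_neq Ex; have [ux _ _] := triple_neq Ex.
    have eEy : connect (line_graph G) e (triple y u v).
      by apply: (nbr_connect uB); rewrite ?in_triple ?eqxx ?orbT.
    have eEx : connect (line_graph G) e (triple x u v).
      apply: connect_trans eEy _; apply: (connect_common_pair Ey Ex uv);
      by rewrite ?in_triple ?eqxx ?orbT.
    have : u \in nbr e x by apply: (mem_nbr Ex); rewrite ?in_triple ?eqxx ?orbT.
    by rewrite ex0 inE.
  rewrite in_setU !in_setX !inP /= -uvA -uvB (negbTE uB) uV vV.
  by case: (u \in A).
(* Sum over the cell of the first entry; the second entry avoids the opposite cell. *)
have cupL : #|Lx :|: Ly| <=
    #|P true true| * (#|V'| - #|P false false|)
  + #|P true false| * (#|V'| - #|P false true|)
  + #|P false true| * (#|V'| - #|P true false|)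
  + #|P false false| * (#|V'| - #|P true true|).
  have cD a b : #|V'| - #|P a b| = #|V' :\: P a b|.
    rewrite cardsD (setIidPr _) //.
    by apply/subsetP=> u; rewrite inP => /andP[].
  rewrite !cD -!cardsX; apply: leq_trans (leq_add (leq_trans (card_setU_le _ _)
    (leq_add (card_setU_le _ _) (leqnn _))) (leqnn _)).
  apply: leq_trans (card_setU_le _ _).
  apply: subset_leq_card; apply/subsetP=> -[u v] uvL.
  have [uV vV uvAB] : [/\ u \in V', v \in V' &
      (u \in A) = (v \in A) \/ (u \in B) = (v \in B)].
    by case/setUP: uvL => [/LxP|/LyP] [-> -> ->]; split=> //; [left|right].
  rewrite !in_setU !in_setX !in_setD !inP /= uV vV /=.
  by move: uvAB; case: (u \in A); case: (u \in B); case: (v \in A);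
    case: (v \in B) => // -[].
have := cardsUI Lx Ly.
have := link_split x y; have := link_split y x; rewrite (colinkC y x) -/Lx -/Ly.
have := leq_trans (deg_large xV) (degree_link x).
have := leq_trans (deg_large yV) (degree_link y).
rewrite cV /= in majx majy *; have := bin2_double #|V'|.
move: codeg capL cupL cVP cA cB majx majy.
move: #|Lx| #|Ly| #|link x| #|link y| #|Lx :|: Ly| #|Lx :&: Ly| #|colink x y|.
move: #|A| #|B| #|V'| 'C(_, _) => a b N bin lx ly kx ky U I p.
rewrite ltnNge => codeg capL cupL cVP cA cB majx majy *; apply/negP=> le_ab.
(* Write i, al, be, o for the cells TT, TF, FT, FF, N for [#|V'|] and p for the codegree. Adding the
   two degree bounds gives N + 4 <= al^2 + o^2 - 2 i o - 2 al be + 4p. The two majorities force i >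
   o, and [le_ab] forces be >= al + [y in A]. Hence N + 4 <= 4p - al^2 - 2 al [y in A] - o^2 - 2o.
   As p is at most al or o according to whether [y] is in [A], the right side is at most 2 al or 2o,
   while N >= al + be and N >= i + o. *)
have : #|P false false|.+1 * #|P false false|
    <= #|P true true| * #|P false false|.
  by rewrite leq_mul2r; apply/orP; right; case: (y \in A) cA; lia.
have : #|P true false| * (#|P true false| + (y \in A))
    <= #|P true false| * #|P false true|.
  by rewrite leq_mul2l; apply/orP; right; lia.
rewrite -!mulnn in capL; case: (y \in A) codeg cA => /= codeg cA;
move: #|P true true| #|P true false| #|P false true| #|P false false|
  codeg capL cupL cVP cA cB => i al be o codeg capL cupL cVP cA cB ? ?.
all: have {}cupL :
    U <= i * (i + al + be) + al * (al + i + o) + be * (be + i + o)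
         + o * (o + al + be)
  by apply: leq_trans cupL _; rewrite !leq_add // leq_mul //; lia.
all: subst N; lia.
Qed.

Lemma exists_spanning_class : verts G != set0 ->
  exists2 e, e \in edges G & forall x, x \in verts G ->
    exists2 f, f \in line_class e & x \in f.
Proof.
case/set0Pn=> x0 x0V; have [e0 e0E maj0] := majority_nbr x0V.
pose D p := (p.1 \in edges G) && (p.2 \in verts G).
have D0 : D (e0, x0) by apply/andP.
case: (arg_maxnP (fun p : {set T} * T => #|nbr p.1 p.2|) D0) => -[e y] /=.
case/andP=> /= eE yV max_ey; exists e => // x xV.
have [e' e'E majx] := majority_nbr xV.
have [ex0|/set0Pn[u /nbrP[_ [f [fE ef xf _]]]]] := eqVneq (nbr e x) set0;
  last first.
  by exists f; rewrite // inE fE.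
(* The maximal pair does at least as well as [(e0, x0)], which has a majority. *)
have majy : #|verts G| < #|nbr e y|.*2.
  by apply: leq_trans maj0 _; rewrite leq_double; exact: max_ey D0.
have := missing_nbr_lt xV yV ex0 majy majx.
have := max_ey (e', x); rewrite /D /= e'E xV => /(_ isT).
by rewrite ltnNge => ->.
Qed.

End TightComponents.

(** * The component of an edge *)

Section ClassComponent.
Set Implicit Arguments.

Variables (T : finType) (G : tgraph T) (e : {set T}).

(** Taking all of [verts G] makes it spanning by construction; what remains to show is that no
    vertex is isolated. *)
Definition class_graph : tgraph T.
Proof.
apply: (@TGraph T (verts G) (line_class G e)) => f; rewrite inE => /andP[fE _].
- exact: edges_card3 fE.
- exact: edges_sub fE.
Defined.

(** A path in the line graph that starts in the class never leaves it. *)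
Lemma connect_line_class f g : f \in line_class G e ->
  connect (line_graph G) f g ->
  connect (induced (line_graph G) (line_class G e)) f g.
Proof.
move=> fC /connectP[p]; elim: p f fC => [|h p IHp] f fC /=.
  by move=> _ ->; apply: connect0.
case/andP=> fh hp gE; have hC : h \in line_class G e.
  move: fC (fh); rewrite !inE => /andP[_ ef] /and3P[_ -> _] /=.
  exact: connect_trans ef (connect1 fh).
by apply: connect_trans (connect1 _) (IHp h hC hp gE);
  rewrite /induced /= fC hC.
Qed.

Lemma class_graph_component : e \in edges G ->
  (forall x, x \in verts G -> exists2 f, f \in line_class G e & x \in f) ->
  tight_component G class_graph.
Proof.
move=> eE cover; have eC : e \in line_class G e by rewrite inE eE connect0.
split.
  split=> //; first by split=> //=; apply/subsetP=> f; rewrite inE => /andP[].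
  split=> [|f g fC gC]; first by apply/set0Pn; exists e.
  apply: connect_line_class => //.
  move: fC gC; rewrite !inE => /andP[_ ef] /andP[_ eg].
  by apply: connect_trans eg; rewrite connect_line_sym.
move=> H [[_ HG] _ [_ Hconn]] CH; apply/eqP; rewrite eqEsubset CH andbT.
apply/subsetP=> f fH; rewrite inE (subsetP HG) //=.
(* Maximality: any connected [H] containing [e] has only edges reachable from [e]. *)
have := Hconn e f (subsetP CH e eC) fH; apply: connect_sub => g h.
by case/and3P=> _ _ gh; apply: connect1.
Qed.

End ClassComponent.

(** * From minimum degree to a spanning component *)

Lemma min_degree_le (T : finType) (G : tgraph T) v :
  v \in verts G -> (min_degree G <= degree G v)%N.
Proof.
by move=> vV; apply/bigmax_leqP=> m /forallP/(_ v)/implyP; apply.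
Qed.

Theorem theorem1p2 (T : finType) (G : tgraph T) (n : nat)
    (card_verts : #|verts G| = n)
    (deg_cond : 1 / 2 * 'C(n - 1, 2)%:R + 1 <= (min_degree G)%:R :> rat) :
  exists C : tgraph T, tight_component G C /\ spanning G C.
Proof.
have min_large : ('C(n.-1, 2) + 2 <= (min_degree G).*2)%N.
  rewrite -(ler_nat rat) -muln2 natrD natrM -subn1; lra.
have deg_large v : v \in verts G ->
    ('C(#|verts G|.-1, 2) + 2 <= (degree G v).*2)%N.
  move=> vV; rewrite card_verts; apply: leq_trans min_large _.
  by rewrite leq_double min_degree_le.
(* Without vertices there are no edges, so the maximum in [min_degree] ranges over m = 0 only,
   against the lower bound 2. *)
have V_neq0 : verts G != set0.
  apply: contraTneq min_large => V0; rewrite -ltnNge.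
  suff -> : min_degree G = 0%N by rewrite addn2.
  apply/eqP; rewrite -leqn0; apply/bigmax_leqP=> -[m /= lt_m] _.
  suff E0 : edges G = set0 by move: lt_m; rewrite E0 cards0.
  apply/setP=> f; rewrite inE; apply/negP=> fE.
  have := edges_sub fE; rewrite V0 subset0 => /eqP f0.
  by have := edges_card3 fE; rewrite f0 cards0.
have [e eE cover] := exists_spanning_class deg_large V_neq0.
by exists (class_graph G e); split=> //; apply: class_graph_component.
Qed.
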